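(* Let $n=2m$ with $m\ge1$. Then the maximum of $\mathrm{s}^*_{\mathcal B}$ over all permutations in $S_n$ is $\left(m^m(m+1)^{m-1}\right)^{1/(2m-1)}$, and it is attained precisely by the following two permutations: the permutation $\pi$ given by $\pi(2i)=n-i+1$, $\pi(2i-1)=m-i+1$ for $1\le i\le m$, and the permutation $\pi'$ given by $\pi'(2i)=i$, $\pi'(2i-1)=m+i$ for $1\le i\le m$.
   Context: $S_n$ is the set of all permutations of $\{1,\dots,n\}$. For $n\ge2$ and $\pi\in S_n$, $$\mathrm{s}^*_{\mathcal B}(\pi)=\left(\prod_{i=1}^{n-1}|\pi(i)-\pi(i+1)|\right)^{1/(n-1)}$$ (the multiplicative stretch of $\pi$ with respect to $\mathcal B=\{\{i,i+1\}:1\le i<n\}$). *)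

(* Defs.v *)
From mathcomp Require Import all_boot all_order all_algebra all_fingroup.
From mathcomp Require Import all_classical all_reals all_analysis.

Set Implicit Arguments.
Unset Strict Implicit.
Unset Printing Implicit Defensive.

Import Order.TTheory GRing.Theory Num.Theory.

Local Open Scope ring_scope.

(* 'S_n permutes {0, ..., n-1}; [at1 s] is the same permutation acting on
   {1, ..., n}: position k and its value are both shifted by one. Only
   1 <= k <= n is meaningful (the value is 0 when k > n). *)
Definition at1 (n : nat) (s : 'S_n) (k : nat) : nat :=
  oapp (fun j : 'I_n => (s j).+1) 0%N (insub k.-1).

Definition mstretch (R : realType) (n : nat) (s : 'S_n) : R :=
  (\prod_(1 <= i < n) `|(at1 s i)%:R - (at1 s i.+1)%:R|) `^ (n - 1)%:R^-1.

(* Main.v *)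
(* Put d_i = |s(i) - s(i+1)|.  Comparing both endpoints with the centre
   (2m+1)/2 gives sum d_i <= 2m^2 - 1, since every value is counted twice except
   s(1) and s(n), each at distance at least 1/2 from the centre.  With
   q = (m+1)/m the map d |-> d / q^d on the natural numbers is maximal exactly
   at d = m and d = m+1; multiplying the inequalities d_i q^m <= m q^(d_i) and
   using the bound on the sum gives the maximum.  In the equality case all d_i
   lie in {m, m+1}, and the graph on {1, ..., 2m} joining values at distance
   m or m+1 is the path m+1, 1, m+2, 2, ..., 2m, m, which has only two
   Hamiltonian paths. *)
Require Import Defs.
From mathcomp Require Import all_boot all_order all_algebra all_fingroup.
From mathcomp Require Import all_classical all_reals all_analysis.
From mathcomp Require Import zify ring.

Set Implicit Arguments.
Unset Strict Implicit.
Unset Printing Implicit Defensive.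

Import Order.TTheory GRing.Theory Num.Theory.

Local Open Scope ring_scope.

(** * Absolute differences in [nat] and permutations acting on {1, ..., n} *)

Definition distn (a b : nat) : nat := ((a - b) + (b - a))%N.

Lemma distnE (R : realDomainType) (a b : nat) :
  `|a%:R - b%:R| = (distn a b)%:R :> R.
Proof.
rewrite /distn; case: (leqP a b) => [le_ab|/ltnW le_ba].
- by rewrite (eqP le_ab) add0n natrB // distrC ger0_norm // subr_ge0 ler_nat.
- by rewrite (eqP le_ba) addn0 natrB // ger0_norm // subr_ge0 ler_nat.
Qed.

Lemma distnC (a b : nat) : distn a b = distn b a.
Proof. exact: addnC. Qed.

Lemma at1S (n : nat) (s : 'S_n) (i : 'I_n) : at1 s i.+1 = (s i).+1.
Proof. by rewrite /at1 /= valK. Qed.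

Lemma at1_ge1 (n : nat) (s : 'S_n) (k : nat) :
  (1 <= k <= n)%N -> (1 <= at1 s k <= n)%N.
Proof.
case: k => // k /= lt_kn.
by rewrite (at1S s (Ordinal lt_kn)) /= ltn_ord.
Qed.

Lemma at1_inj (n : nat) (s : 'S_n) (j k : nat) :
  (1 <= j <= n)%N -> (1 <= k <= n)%N -> at1 s j = at1 s k -> j = k.
Proof.
case: j k => // j [] // k /= lt_jn lt_kn.
rewrite (at1S s (Ordinal lt_jn)) (at1S s (Ordinal lt_kn)) => -[/val_inj].
by move=> /perm_inj[->].
Qed.

Lemma eq_perm_at1 (n : nat) (s t : 'S_n) :
  (forall k, (1 <= k <= n)%N -> at1 s k = at1 t k) -> s = t.
Proof.
move=> eq_st; apply/permP => i; apply: val_inj.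
by have := eq_st i.+1 (ltn_ord i); rewrite !at1S => -[].
Qed.

Lemma sum_at1 (n : nat) (s : 'S_n) (F : nat -> nat) :
  (\sum_(1 <= k < n.+1) F (at1 s k) = \sum_(1 <= k < n.+1) F k)%N.
Proof.
rewrite !big_add1 /= !big_mkord [RHS](reindex_inj (@perm_inj _ s)).
by apply: eq_bigr => i _; rewrite at1S.
Qed.

(** * Bound on the sum of distances between neighbours *)

(* [distn (2 * v) (2 * m + 1)] is twice the distance of v to the centre. *)
Lemma sum_dist_center (m : nat) :
  (\sum_(1 <= k < (2 * m).+1) distn (2 * k) (2 * m + 1) = 2 * m ^ 2)%N.
Proof.
(* Above the centre the terms are the odd numbers 1, 3, 5, ..., with partial sums j^2. *)
have tail j : (\sum_(m.+1 <= k < (m + j).+1) distn (2 * k) (2 * m + 1) = j ^ 2)%N.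
  elim: j => [|j IHj]; first by rewrite addn0 big_geq.
  by rewrite addnS big_nat_recr ?IHj /= /distn; lia.
(* Below the centre the terms decrease from 2m - 1; those left after the first j add up to (m -
   j)^2. *)
have head j : (j <= m)%N ->
    (\sum_(1 <= k < j.+1) distn (2 * k) (2 * m + 1) + (m - j) ^ 2 = m ^ 2)%N.
  elim: j => [|j IHj] le_jm; first by rewrite big_geq // subn0.
  rewrite big_nat_recr //= -[RHS](IHj (ltnW le_jm)) /distn.
  have -> : (m - j = (m - j.+1).+1)%N by lia.
  lia.
rewrite (big_cat_nat _ (n := m.+1)) //=; last by lia.
have := head m (leqnn m); rewrite subnn addn0 => ->.
by rewrite [in X in index_iota _ X]mul2n -addnn tail; lia.
Qed.

Lemma sum_distn_at1 (m : nat) (s : 'S_(2 * m)) : (1 <= m)%N ->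
  (\sum_(1 <= i < 2 * m) distn (at1 s i) (at1 s i.+1) <= 2 * m ^ 2 - 1)%N.
Proof.
move=> m_gt0; pose w k := distn (2 * at1 s k) (2 * m + 1).
(* An even and an odd number differ by at least 1. *)
have w_gt0 k : (1 <= w k)%N by rewrite /w /distn; lia.
have sum_w : (\sum_(1 <= k < (2 * m).+1) w k = 2 * m ^ 2)%N.
  by rewrite (sum_at1 s (fun v => distn (2 * v) (2 * m + 1))) sum_dist_center.
(* Left endpoints miss only the last position and right endpoints only the first; each loses at
   least 1, so the doubled sum is at most 4m^2 - 2. *)
have suml : (\sum_(1 <= k < 2 * m) w k + w (2 * m) = 2 * m ^ 2)%N.
  by rewrite -sum_w big_nat_recr //=; lia.
have sumr : (w 1 + \sum_(1 <= k < 2 * m) w k.+1 = 2 * m ^ 2)%N.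
  by rewrite -sum_w big_nat_recl //=; lia.
have : (\sum_(1 <= i < 2 * m) 2 * distn (at1 s i) (at1 s i.+1) <=
        \sum_(1 <= i < 2 * m) (w i + w i.+1))%N.
  by apply: leq_sum => i _; rewrite /w /distn; lia.
rewrite -big_distrr [X in (_ <= X)%N]big_split /=.
by have := w_gt0 1%N; have := w_gt0 (2 * m)%N; lia.
Qed.

(** * Comparison of d with powers of q, and the product bound *)

Section GeometricBound.
Variables (R : realFieldType) (m : nat).
Hypothesis m_gt0 : (1 <= m)%N.

Let q : R := m.+1%:R / m%:R.

Let m_pos : 0 < m%:R :> R. Proof. by rewrite ltr0n. Qed.

Let q_gt1 : 1 < q.
Proof. by rewrite /q ltr_pdivlMr // mul1r ltr_nat. Qed.

Let q_gt0 : 0 < q. Proof. exact: lt_trans q_gt1. Qed.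

Lemma geometric_boundSm : m.+1%:R * q ^+ m = m%:R * q ^+ m.+1.
Proof. by rewrite exprS mulrA /q [m%:R * _]mulrC divfK ?gt_eqF. Qed.

(** Raising d by one scales q^d by (m + 1)/m, and (d + 1)m exceeds d(m + 1) for d < m but falls
    below it for d > m. The inequality thus spreads downwards from m and upwards from m + 1. *)
Lemma geometric_bound_lt (d : nat) :
  d != m -> d != m.+1 -> d%:R * q ^+ m < m%:R * q ^+ d.
Proof.
have below k : (k < m)%N -> (m - k.+1)%:R * q ^+ m < m%:R * q ^+ (m - k.+1).
  (* A weak hypothesis with a strict conclusion lets the induction start from the equality at m. *)
  have step e : (e < m)%N -> e.+1%:R * q ^+ m <= m%:R * q ^+ e.+1 ->
      e%:R * q ^+ m < m%:R * q ^+ e.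
    move=> lt_em; rewrite exprS mulrCA -ler_pdivrMl // => H.
    apply: lt_le_trans H; rewrite mulrA ltr_pM2r ?exprn_gt0 //.
    rewrite ltr_pdivlMl // /q mulrAC ltr_pdivrMr // -!natrM ltr_nat.
    by rewrite mulSn mulSn; lia.
  elim: k => [|k IHk] lt_km.
    by apply: step; rewrite ?subn1 prednK.
  apply: step; first by lia.
  have -> : ((m - k.+2).+1 = m - k.+1)%N by lia.
  exact/ltW/IHk/ltnW.
have above k : (m.+1 + k.+1)%:R * q ^+ m < m%:R * q ^+ (m.+1 + k.+1).
  have step e : (m < e)%N -> e%:R * q ^+ m <= m%:R * q ^+ e ->
      e.+1%:R * q ^+ m < m%:R * q ^+ e.+1.
    move=> lt_me; rewrite exprS mulrCA => H.
    apply: (@lt_le_trans _ _ (q * (e%:R * q ^+ m))); last by rewrite ler_pM2l.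
    rewrite mulrA ltr_pM2r ?exprn_gt0 // /q mulrAC ltr_pdivlMr //.
    by rewrite -!natrM ltr_nat mulSn mulSn; lia.
  elim: k => [|k IHk]; rewrite addnS; apply: step; rewrite ?addn0 ?geometric_boundSm //.
    by lia.
  exact: ltW.
move=> neq_dm neq_dSm; case: (ltnP d m) => [lt_dm|le_md].
  have -> : (d = m - (m - d.+1).+1)%N by lia.
  by apply: below; lia.
have -> : (d = m.+1 + (d - m.+2).+1)%N by lia.
exact: above.
Qed.

Lemma geometric_bound (d : nat) : d%:R * q ^+ m <= m%:R * q ^+ d.
Proof.
have [->//|neq_dm] := eqVneq d m.
have [->|neq_dSm] := eqVneq d m.+1; first by rewrite geometric_boundSm.
exact/ltW/geometric_bound_lt.
Qed.

Section Product.
Variable (d : nat -> nat).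
Hypothesis sum_d : (\sum_(1 <= i < 2 * m) d i <= 2 * m ^ 2 - 1)%N.

(** The product of m distances equal to m and m - 1 distances equal to m + 1. *)
Let A : R := m%:R ^+ m * (m + 1)%:R ^+ (m - 1).

Let prod_geometric_le :
  \prod_(1 <= i < 2 * m) (m%:R * q ^+ d i)
    <= A * \prod_(1 <= i < 2 * m) q ^+ m.
Proof.
rewrite big_split /= !prodr_const_nat -expr_sum -exprM.
apply: (@le_trans _ _ (m%:R ^+ (2 * m - 1) * q ^+ (2 * m ^ 2 - 1))).
  by rewrite ler_pM2l ?exprn_gt0 // ler_weXn2l // ltW.
(* Since mq = m + 1, the m - 1 surplus factors q turn as many factors m into m + 1. *)
have -> : (2 * m ^ 2 - 1 = (m - 1) + m * (2 * m - 1))%N by nia.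
rewrite exprD mulrA ler_pM2r ?exprn_gt0 // /A addn1.
have -> : (2 * m - 1 = m + (m - 1))%N by lia.
by rewrite exprD -mulrA -exprMn /q [_ * (_ / _)]mulrC divfK ?gt_eqF.
Qed.

Lemma prod_le_geometric :
  \prod_(1 <= i < 2 * m) (d i)%:R <= A.
Proof.
rewrite -(@ler_pM2r _ (\prod_(1 <= i < 2 * m) q ^+ m)); last first.
  by apply: prodr_gt0 => i _; rewrite exprn_gt0.
apply: le_trans prod_geometric_le; rewrite -big_split /=.
apply: ler_prod => i _; rewrite geometric_bound andbT.
by rewrite mulr_ge0 ?ler0n // ltW // exprn_gt0.
Qed.

(** A single distance outside {m, m + 1} would make the comparison of products strict, against
    [prod_geometric_le]. *)
Lemma prod_eq_geometric :
  \prod_(1 <= i < 2 * m) (d i)%:R = A ->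
  forall i, (1 <= i < 2 * m)%N -> d i = m \/ d i = m.+1.
Proof.
move=> eqA i i_bnd; have [|neq_dm] := eqVneq (d i) m; first by left.
have [|neq_dSm] := eqVneq (d i) m.+1; first by right.
have := prod_geometric_le; rewrite -eqA -big_split /=.
have i_in : i \in index_iota 1 (2 * m) by rewrite mem_index_iota.
rewrite !(bigD1_seq i) ?iota_uniq //= leNgt; case/negP.
(* [G] has only positive factors and so preserves strictness; the corresponding product on the left
   may vanish. *)
set G := (X in _ < _ * X).
apply: (@le_lt_trans _ _ ((d i)%:R * q ^+ m * G)); last first.
  rewrite ltr_pM2r ?geometric_bound_lt //.
  by apply: prodr_gt0 => j _; rewrite mulr_gt0 ?exprn_gt0.
apply: ler_wpM2l; first by rewrite mulr_ge0 ?ler0n // ltW // exprn_gt0.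
apply: ler_prod => j _; rewrite geometric_bound andbT.
by rewrite mulr_ge0 ?ler0n // ltW // exprn_gt0.
Qed.
End Product.
End GeometricBound.

(** * Walks with unit steps, and permutations built from formulas *)

(** Turning back would repeat a value, so all steps have the sign of the first one. A monotone walk
    through n values below n must then start at 0 or at n - 1. *)
Lemma injective_unit_steps (n : nat) (h : nat -> nat) :
  (forall i, (i < n)%N -> (h i < n)%N) ->
  (forall i j, (i < n)%N -> (j < n)%N -> h i = h j -> i = j) ->
  (forall i, (i.+1 < n)%N -> distn (h i) (h i.+1) = 1%N) ->
  (forall i, (i < n)%N -> h i = i) \/
  (forall i, (i < n)%N -> h i = (n - i.+1)%N).
Proof.
rewrite /distn => h_lt h_inj h_step.
have [n_le1|n_gt1] := leqP n 1; first by left=> i lt_in; have := h_lt i lt_in; lia.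
have turn i : (i.+2 < n)%N -> h i.+2 <> h i.
  by move=> lt_in eq_h; have := h_inj _ _ lt_in (ltnW (ltnW lt_in)) eq_h; lia.
have [up|down] : h 1%N = (h 0%N).+1 \/ h 0%N = (h 1%N).+1.
  by have := h_step 0%N n_gt1; lia.
- have Sh i : (i.+1 < n)%N -> h i.+1 = (h i).+1.
    elim: i => // i IHi lt_in.
    by have := turn i lt_in; have := h_step _ lt_in; have := IHi (ltnW lt_in); lia.
  have hE i : (i < n)%N -> h i = (h 0 + i)%N.
    elim: i => [|i IHi] lt_in; first by rewrite addn0.
    by rewrite Sh // IHi ?addnS // ltnW.
  left=> i lt_in; have n1 : (n.-1 < n)%N by lia.
  by have := hE _ lt_in; have := hE _ n1; have := h_lt _ n1; lia.
- have Sh i : (i.+1 < n)%N -> h i = (h i.+1).+1.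
    elim: i => // i IHi lt_in.
    by have := turn i lt_in; have := h_step _ lt_in; have := IHi (ltnW lt_in); lia.
  have hE i : (i < n)%N -> (h i + i = h 0)%N.
    elim: i => [|i IHi] lt_in; first by rewrite addn0.
    by rewrite addnS -addSn -Sh // IHi // ltnW.
  right=> i lt_in; have n1 : (n.-1 < n)%N by lia.
  have := h_lt 0%N (ltnW n_gt1).
  by have := hE _ lt_in; have := hE _ n1; lia.
Qed.

Lemma exists_perm_at1 (n : nat) (f : nat -> nat) :
  (forall k, (1 <= k <= n)%N -> (1 <= f k <= n)%N) ->
  (forall j k, (1 <= j <= n)%N -> (1 <= k <= n)%N -> f j = f k -> j = k) ->
  exists s : 'S_n, forall k, (1 <= k <= n)%N -> at1 s k = f k.
Proof.
(* The default [i] of [insubd] is never taken, since [f_bnd] keeps the value in range. *)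
move=> f_bnd f_inj; pose g (i : 'I_n) := insubd i (f i.+1).-1.
have gE i : (g i).+1 = f i.+1.
  have := f_bnd i.+1 (ltn_ord i) => ?.
  by rewrite insubdK ?prednK -?topredE /=; lia.
have g_inj : injective g.
  move=> i j eq_g; apply/val_inj/succn_inj/f_inj; rewrite ?ltn_ord //.
  by rewrite -!gE eq_g.
exists (perm g_inj) => -[//|k] /= lt_kn.
by rewrite (at1S _ (Ordinal lt_kn)) permE gE.
Qed.

(** * The path of values at distance m or m + 1 *)

(** This is [p'] as a function of the position; read backwards it gives [p]. *)
Definition zigzag (m k : nat) : nat := if odd k then (m + k.+1./2)%N else k./2.

(* The position, counted from 0, of v in the path m+1, 1, m+2, 2, ..., 2m, m. *)
Definition zigzag_rank (m v : nat) : nat :=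
  if (v <= m)%N then (2 * v - 1)%N else (2 * (v - m.+1))%N.

Lemma zigzagK (m k : nat) : (1 <= k <= 2 * m)%N -> zigzag_rank m (zigzag m k) = k.-1.
Proof. by rewrite /zigzag_rank /zigzag; case: ifP; case: ifP; lia. Qed.

Lemma zigzag_bound (m k : nat) : (1 <= k <= 2 * m)%N -> (1 <= zigzag m k <= 2 * m)%N.
Proof. by rewrite /zigzag; case: ifP; lia. Qed.

Lemma zigzag_rank_inj (m u v : nat) : (1 <= u <= 2 * m)%N -> (1 <= v <= 2 * m)%N ->
  zigzag_rank m u = zigzag_rank m v -> u = v.
Proof. by rewrite /zigzag_rank; case: ifP; case: ifP; lia. Qed.

Lemma zigzag_inj (m j k : nat) : (1 <= j <= 2 * m)%N -> (1 <= k <= 2 * m)%N ->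
  zigzag m j = zigzag m k -> j = k.
Proof. by rewrite /zigzag; case: ifP; case: ifP; lia. Qed.

Lemma zigzag_step (m k : nat) : (1 <= k)%N ->
  distn (zigzag m k) (zigzag m k.+1) = if odd k then m else m.+1.
Proof. by rewrite /distn /zigzag /=; case: (boolP (odd k)) => /=; lia. Qed.

(** Two values at distance at least m lie on opposite sides of the centre. If u is the smaller, its
    rank is 2u - 1, and v = u + m or u + m + 1 has rank 2u - 2 or 2u. *)
Lemma zigzag_rank_step (m u v : nat) :
  (1 <= u <= 2 * m)%N -> (1 <= v <= 2 * m)%N ->
  distn u v = m \/ distn u v = m.+1 ->
  distn (zigzag_rank m u) (zigzag_rank m v) = 1%N.
Proof. by rewrite /distn /zigzag_rank; case: ifP; case: ifP; lia. Qed.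

(** The ranks of the successive values form an injective walk with unit steps, hence run straight up
    or straight down. *)
Lemma zigzag_unique (m : nat) (s : 'S_(2 * m)) :
  (forall i, (1 <= i < 2 * m)%N ->
     distn (at1 s i) (at1 s i.+1) = m \/ distn (at1 s i) (at1 s i.+1) = m.+1) ->
  (forall k, (1 <= k <= 2 * m)%N -> at1 s k = zigzag m k) \/
  (forall k, (1 <= k <= 2 * m)%N -> at1 s k = zigzag m (2 * m + 1 - k)).
Proof.
move=> s_step; pose h i := zigzag_rank m (at1 s i.+1).
have [||i lt_in|hE|hE] := @injective_unit_steps (2 * m) h.
- move=> i lt_in; have := @at1_ge1 _ s i.+1 lt_in.
  by rewrite /h /zigzag_rank; case: ifP; lia.
- move=> i j lt_in lt_jn /zigzag_rank_inj eq_h.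
  apply: succn_inj; apply: (@at1_inj _ s i.+1 j.+1 lt_in lt_jn).
  by apply: eq_h; apply: at1_ge1.
- by apply: zigzag_rank_step; [apply: at1_ge1|apply: at1_ge1|apply: s_step]; lia.
- left=> k k_bnd; apply: (@zigzag_rank_inj m); rewrite ?at1_ge1 ?zigzag_bound //.
  by rewrite zigzagK //; case: k k_bnd => // k /hE.
- right=> k k_bnd; apply: (@zigzag_rank_inj m); rewrite ?at1_ge1 ?zigzag_bound //.
    by lia.
  rewrite zigzagK; last by lia.
  by case: k k_bnd => // k /hE; rewrite /h => ->; lia.
Qed.

(** * The extremal value and the permutations attaining it *)

Lemma prod_alternate (R : comNzRingType) (a b : R) (m : nat) : (1 <= m)%N ->
  \prod_(1 <= i < 2 * m) (if odd i then a else b) = a ^+ m * b ^+ (m - 1).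
Proof.
case: m => // m _; rewrite subn1 /=.
elim: m => [|m IHm]; first by rewrite big_nat1 /= mulr1.
have -> : (2 * m.+2 = (2 * m.+1).+2)%N by lia.
have odd_2m : odd (2 * m.+1) = false by rewrite mul2n odd_double.
rewrite big_nat_recr; last by lia.
rewrite big_nat_recr; last by lia.
by rewrite IHm [odd (2 * m.+1).+1]oddS odd_2m !exprS /=; ring.
Qed.

Lemma mstretchE (R : realType) (n : nat) (s : 'S_n) :
  mstretch R s =
    (\prod_(1 <= i < n) (distn (at1 s i) (at1 s i.+1))%:R) `^ (n - 1)%:R^-1.
Proof. by congr (_ `^ _); apply: eq_bigr => i _; rewrite distnE. Qed.

Theorem theorem4p5 (R : realType) (m n : nat) (hm : (1 <= m)%N)
    (hn : n = (2 * m)%N) :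
  let M : R := (m%:R ^+ m * (m + 1)%:R ^+ (m - 1)) `^ (2 * m - 1)%:R^-1 in
  exists p p' : 'S_n,
    [/\ (forall i : nat, (1 <= i <= m)%N ->
           at1 p (2 * i) = (n - i + 1)%N /\
           at1 p (2 * i - 1) = (m - i + 1)%N),
        (forall i : nat, (1 <= i <= m)%N ->
           at1 p' (2 * i) = i /\ at1 p' (2 * i - 1) = (m + i)%N),
        p <> p',
        (forall s : 'S_n, mstretch R s <= M) &
        (forall s : 'S_n, mstretch R s = M <-> s = p \/ s = p')].
Proof.
move=> M; subst n.
have [p' p'E] := exists_perm_at1 (@zigzag_bound m) (@zigzag_inj m).
have [||p pE] := @exists_perm_at1 (2 * m) (fun k => zigzag m (2 * m + 1 - k)).
- by move=> k k_bnd; apply: zigzag_bound; lia.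
- by move=> j k j_bnd k_bnd /zigzag_inj; lia.
have r_gt0 : 0 < (2 * m - 1)%:R^-1 :> R by rewrite invr_gt0 ltr0n; lia.
have A_ge0 : 0 <= m%:R ^+ m * (m + 1)%:R ^+ (m - 1) :> R.
  by rewrite mulr_ge0 ?exprn_ge0.
have P_ge0 (s : 'S_(2 * m)) :
    0 <= \prod_(1 <= i < 2 * m) (distn (at1 s i) (at1 s i.+1))%:R :> R.
  by apply: prodr_ge0.
have attained (s : 'S_(2 * m)) :
    (forall i, (1 <= i < 2 * m)%N ->
       distn (at1 s i) (at1 s i.+1) = if odd i then m else m.+1) ->
    mstretch R s = M.
  move=> s_step; rewrite mstretchE /M addn1 -prod_alternate //.
  congr (_ `^ _); apply: eq_big_nat => i i_bnd.
  by rewrite s_step //; case: odd.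
exists p, p'; split.
- move=> i i_bnd; rewrite !pE; [|lia|lia].
  by rewrite /zigzag; split; case: ifP; lia.
- move=> i i_bnd; rewrite !p'E; [|lia|lia].
  by rewrite /zigzag; split; case: ifP; lia.
(* At position 1, [zigzag_inj] would force 2m = 1. *)
- move=> eq_p; have m_bnd : (1 <= 1 <= 2 * m)%N by lia.
  have := pE 1%N m_bnd; rewrite eq_p p'E // => /zigzag_inj; lia.
- move=> s; rewrite mstretchE ge0_ler_powR ?nnegrE ?(ltW r_gt0) //.
  exact: (prod_le_geometric R hm (sum_distn_at1 s hm)).
move=> s; split=> [|[]->].
(* The root is injective on nonnegative reals, so equality of stretches gives equality of
   products. *)
- rewrite mstretchE => /(powR_injective r_gt0); rewrite !nnegrE => /(_ (P_ge0 s) A_ge0).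
  move=> /(prod_eq_geometric hm (sum_distn_at1 s hm)) /zigzag_unique[sE|sE].
  + by right; apply: eq_perm_at1 => k k_bnd; rewrite sE // p'E.
  + by left; apply: eq_perm_at1 => k k_bnd; rewrite sE // pE.
- apply: attained => i i_bnd; rewrite !pE; [|lia|lia].
  (* Step i of [p] is step 2m - i of the path reversed, and 2m - i has the parity of i. *)
  have -> : (2 * m + 1 - i = (2 * m + 1 - i.+1).+1)%N by lia.
  have -> : odd i = odd (2 * m + 1 - i.+1) by lia.
  by rewrite distnC zigzag_step //; lia.
- by apply: attained => i i_bnd; rewrite !p'E ?zigzag_step //; lia.
Qed.
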